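(* Equip $\mathbb{R}^+\times S^3\times S^3$ (with radial coordinate $r>0$) with the conical Bryant–Salamon $G_2$-structure. Let $k\in\mathbb{R}^+$ and let $a_1,a_2,a_3\in\mathbb{R}$, not all zero. Let $W$ denote the Lambert $W$ function, i.e. the inverse of $h(x)=xe^x$ (on $[0,\infty)$), and set $$f(r)=\frac1k\exp\!\Big(\tfrac12\,W\Big(\frac{4k^2r^4}{27(a_1^2+a_2^2+a_3^2)}\Big)\Big),\qquad r>0.$$ Then $$A=f(r)\,(a_1\eta_1^++a_2\eta_2^++a_3\eta_3^+)$$ is a deformed $G_2$-instanton on $\mathbb{R}^+\times S^3\times S^3$, i.e. $F_A=dA$ satisfies $\frac16F_A^3-F_A\wedge*_\varphi\varphi=0$.
   Context: Conventions: the gauge group is $U(1)$, its Lie algebra is identified with $\mathbb{R}$, a connection on the trivial line bundle is a real $1$-form $A$, and its curvature is $F_A=dA$ (powers are wedge powers). Invariant forms: let $T_1,T_2,T_3$ be the basis of $\mathfrak{su}_2$ with $[T_i,T_j]=2\varepsilon_{ijk}T_k$. On $S^3\times S^3=SU(2)\times SU(2)$ use the left-invariant vector fields $T_i^+=(T_i,T_i)$, $T_i^-=(T_i,-T_i)$ and denote by $\eta_i^\pm$ the dual coframe, so that $d\eta_i^+=-\varepsilon_{ijk}(\eta_j^+\wedge\eta_k^++\eta_j^-\wedge\eta_k^-)$ and $d\eta_i^-=-2\varepsilon_{ijk}\,\eta_j^-\wedge\eta_k^+$ (repeated indices summed). Write $\eta^{\pm\pm}_{ij}=\eta_i^\pm\wedge\eta_j^\pm$,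 etc. (adjacent forms wedged). Given functions $A_1,A_2,B_1,B_2$ of $t$, set $\omega=4A_1B_1\,\eta_{11}^{-+}+4A_2B_2(\eta_{22}^{-+}+\eta_{33}^{-+})$, $\Omega^+=8B_1B_2^2\,\eta_{123}^{---}-8A_2^2B_1\,\eta_{123}^{-++}-8A_1A_2B_2(\eta_{123}^{++-}+\eta_{123}^{+-+})$, $\Omega^-=8A_1B_2^2\,\eta_{123}^{+--}-8A_2^2A_1\,\eta_{123}^{+++}+8B_1B_2A_2(\eta_{123}^{--+}+\eta_{123}^{-+-})$, and $\varphi=dt\wedge\omega+\Omega^+$, $*_\varphi\varphi=\frac12\omega\wedge\omega-dt\wedge\Omega^-$. The conical Bryant–Salamon $G_2$-structure on $\mathbb{R}^+\times S^3\times S^3$ is given by $t=r$, $A_1=A_2=\frac r3$, $B_1=B_2=\frac{r}{\sqrt3}$. *)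

(* Defs.v *)
From HB Require Import structures.
From mathcomp Require Import all_boot all_order all_algebra.
From mathcomp Require Import all_classical all_reals all_analysis.

Set Implicit Arguments.
Unset Strict Implicit.
Unset Printing Implicit Defensive.

Import Order.TTheory GRing.Theory Num.Theory.
Import numFieldNormedType.Exports.

Local Open Scope classical_set_scope.
Local Open Scope ring_scope.

(* A quaternion is a pair (real part, imaginary part); SU(2) = S^3 is the group
   of unit quaternions and su(2) the space of imaginary ones. *)
Notation quat R := (R * 'rV[R]_3)%type.

Definition dot (R : realType) (u v : 'rV[R]_3) : R :=
  \sum_(i < 3) u 0 i * v 0 i.

(* The indices i + 1 and i + 2 are taken modulo 3. *)
Definition cross (R : realType) (u v : 'rV[R]_3) : 'rV[R]_3 :=
  \row_(i < 3) (u 0 (i + 1) * v 0 (i + 2%:R) - u 0 (i + 2%:R) * v 0 (i + 1)).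

Definition mulq (R : realType) (p q : quat R) : quat R :=
  (p.1 * q.1 - dot p.2 q.2, p.1 *: q.2 + q.1 *: p.2 + cross p.2 q.2).

(* The norm is the Euclidean one; the library's `|u| on row vectors is the
   supremum norm. *)
Definition norm2 (R : realType) (u : 'rV[R]_3) : R := Num.sqrt (dot u u).

(* At u = 0 the coefficient of u is the total quotient 0 / 0 = 0, so that
   expq 0 = 1 as it should be. *)
Definition expq (R : realType) (u : 'rV[R]_3) : quat R :=
  (cos (norm2 u), (sin (norm2 u) / norm2 u) *: u).

Definition su2_bracket (R : realType) (u v : 'rV[R]_3) : 'rV[R]_3 :=
  (mulq (0, u) (0, v)).2 - (mulq (0, v) (0, u)).2.

(* T_1, T_2, T_3 are the quaternions i, j, k, whence [T_i, T_j] = 2 eps_ijk T_k. *)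
Definition T (R : realType) (i : 'I_3) : 'rV[R]_3 := delta_mx 0 i.

(* The manifold is the subset M of point R; functions and forms on M are
   represented by functions on point R, of which only the values on M matter. *)
Notation point R := (R * quat R * quat R)%type.

Definition S3 (R : realType) : set (quat R) :=
  [set p | p.1 ^+ 2 + dot p.2 p.2 = 1].

Definition M (R : realType) : set (point R) :=
  [set m | [/\ 0 < m.1.1, S3 m.1.2 & S3 m.2]].

(* The tangent vector (s, x, y) at (r, p, q), left-trivialised, stands for
   s d/dr + (p x, q y). *)
Notation lie R := (R * 'rV[R]_3 * 'rV[R]_3)%type.

Definition lie_bracket (R : realType) (X Y : lie R) : lie R :=
  (0, su2_bracket X.1.2 Y.1.2, su2_bracket X.2 Y.2).

Definition flow (R : realType) (X : lie R) (m : point R) (s : R) : point R :=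
  (m.1.1 + s * X.1.1, mulq m.1.2 (expq (s *: X.1.2)), mulq m.2 (expq (s *: X.2))).

Definition vderiv (R : realType) (X : lie R) (g : point R -> R) : point R -> R :=
  fun m => derive1 (fun s : R => g (flow X m s)) 0.

(* The seven frame fields are numbered d/dr, T_1^+, T_2^+, T_3^+, T_1^-, T_2^-,
   T_3^-; this order also orients the monomials of the exterior algebra. *)
Definition idr : 'I_7 := lshift 3 (lshift 3 (ord0 : 'I_1)).
Definition iplus (i : 'I_3) : 'I_7 := lshift 3 (rshift 1 i).
Definition iminus (i : 'I_3) : 'I_7 := rshift (1 + 3)%N i.

Definition frame (R : realType) (k : 'I_7) : lie R :=
  match @fintype.split (1 + 3)%N 3 k with
  | inl l => match @fintype.split 1 3 l with
             | inl _ => (1, 0, 0)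
             | inr i => (0, T R i, T R i)
             end
  | inr i => (0, T R i, - T R i)
  end.

Definition coframe (R : realType) (k : 'I_7) (X : lie R) : R :=
  match @fintype.split (1 + 3)%N 3 k with
  | inl l => match @fintype.split 1 3 l with
             | inl _ => X.1.1
             | inr i => (X.1.2 0 i + X.2 0 i) / 2
             end
  | inr i => (X.1.2 0 i - X.2 0 i) / 2
  end.

Lemma coframe_frame (R : realType) (k l : 'I_7) :
  coframe k (frame R l) = (k == l)%:R.
Proof.
have half (b : bool) : (b%:R + b%:R) / 2 = b%:R :> R.
  by rewrite -mulr2n -[_ *+ 2]mulr_natr mulfK // pnatr_eq0.
rewrite /coframe /frame; case: (@split_ordP (1 + 3)%N 3 k) => k' ->;
  case: (@split_ordP (1 + 3)%N 3 l) => l' ->;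
  [case: (@split_ordP 1 3 k') => {}k' ->; case: (@split_ordP 1 3 l') => {}l' ->
  |case: (@split_ordP 1 3 k') => {}k' -> |case: (@split_ordP 1 3 l') => {}l' ->
  |]; rewrite -val_eqE ?(ord1 k') ?(ord1 l') /= ?mxE ?eqxx ?opprK /=
    ?addr0 ?subrr ?subr0 ?oppr0 ?mul0r ?half //=.
- by rewrite -addnA eqn_add2l ltn_eqF // ltn_addr.
- by rewrite -addnA eqn_add2l gtn_eqF // ltn_addr.
Qed.

(* Elements of the exterior algebra on the coframe: the value at S is the
   coefficient of the wedge of the coframe elements indexed by S, taken in
   increasing order. *)
Notation ext R := {ffun {set 'I_7} -> R^o}.

Definition monomial (R : realType) (S : {set 'I_7}) : ext R :=
  [ffun A => (A == S)%:R].

(* The sign of the permutation sorting the concatenation of A and B. *)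
Definition shuffle_sign (R : realType) (A B : {set 'I_7}) : R :=
  (-1) ^+ #|[pred ij : 'I_7 * 'I_7 |
               [&& ij.1 \in A, ij.2 \in B & (ij.2 < ij.1)%N]]|.

Definition wedge (R : realType) (a b : ext R) : ext R :=
  [ffun S : {set 'I_7} => \sum_(A : {set 'I_7} | A \subset S)
     shuffle_sign R A (S :\: A) * a A * b (S :\: A)].

Declare Scope ext_scope.
Delimit Scope ext_scope with ext.
Infix "^^" := wedge (at level 40, left associativity) : ext_scope.
Local Open Scope ext_scope.

Definition contract (R : realType) (k : 'I_7) (a : ext R) : ext R :=
  [ffun S : {set 'I_7} =>
     if k \in S then 0 else shuffle_sign R [set k] S * a (k |: S)].

Definition covector (R : realType) (k : 'I_7) : ext R := monomial R [set k].

(* d theta (X, Y) = - theta ([X, Y]) for a left-invariant 1-form theta and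
   left-invariant vector fields X and Y. *)
Definition dcovector (R : realType) (k : 'I_7) : ext R :=
  \sum_(i < 7) \sum_(j < 7 | (i < j)%N)
    (- coframe k (lie_bracket (frame R i) (frame R j)))
      *: (covector R i ^^ covector R j).

Notation form R := (point R -> ext R).

(* The first sum differentiates the coefficients of alpha; the second is the
   antiderivation extending dcovector, applied to the coframe monomials. *)
Definition dform (R : realType) (alpha : form R) : form R := fun m =>
  \sum_(k < 7) covector R k ^^
     ([ffun S : {set 'I_7} => vderiv (frame R k) (fun x => alpha x S) m] : ext R)
  + \sum_(k < 7) dcovector R k ^^ contract k (alpha m).

Definition iter_vderiv (R : realType) (s : seq 'I_7) (g : point R -> R)
  : point R -> R := foldr (fun k => vderiv (frame R k)) g s.

(* C^infinity on M: all iterated derivatives along the frame exist and are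
   continuous. *)
Definition smooth_fun (R : realType) (g : point R -> R) : Prop :=
  forall s : seq 'I_7,
    {within @M R, continuous (iter_vderiv s g)} /\
    forall (k : 'I_7) (m : point R), M m ->
      derivable (fun x : R => iter_vderiv s g (flow (frame R k) m x)) 0 1.

Definition smooth_form (R : realType) (alpha : form R) : Prop :=
  forall S : {set 'I_7}, smooth_fun (fun m => alpha m S).

Definition homogeneous (R : realType) (n : nat) (alpha : form R) : Prop :=
  forall m, M m -> forall S : {set 'I_7}, #|S| != n -> alpha m S = 0.

(* A U(1)-connection on the trivial line bundle, as a real 1-form. *)
Definition connection (R : realType) (A : form R) : Prop :=
  homogeneous 1 A /\ smooth_form A.

(* psi is the 4-form *_phi phi of the G2-structure phi. *)
Definition deformed_G2_instanton (R : realType) (psi A : form R) : Prop :=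
  connection A /\
  forall m, M m ->
    let F := dform A m in
    6^-1 *: (F ^^ F ^^ F) - F ^^ psi m = 0.

Definition dr (R : realType) : ext R := covector R idr.
Definition etap (R : realType) (i : 'I_3) : ext R := covector R (iplus i).
Definition etam (R : realType) (i : 'I_3) : ext R := covector R (iminus i).

(* eta_123 with the signs given by a, b, c. *)
Definition eta123 (R : realType) (a b c : 'I_3 -> ext R) : ext R :=
  a 0 ^^ b 1 ^^ c 2%:R.

Section InvariantForms.

Context {R : realType}.
Local Notation p := (@etap R).
Local Notation m := (@etam R).

Definition omega (A1 A2 B1 B2 : R) : ext R :=
  (4 * A1 * B1) *: (m 0 ^^ p 0)
  + (4 * A2 * B2) *: (m 1 ^^ p 1 + m 2%:R ^^ p 2%:R).

Definition Omega_plus (A1 A2 B1 B2 : R) : ext R :=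
  (8 * B1 * B2 ^+ 2) *: eta123 m m m
  - (8 * A2 ^+ 2 * B1) *: eta123 m p p
  - (8 * A1 * A2 * B2) *: (eta123 p p m + eta123 p m p).

Definition Omega_minus (A1 A2 B1 B2 : R) : ext R :=
  (8 * A1 * B2 ^+ 2) *: eta123 p m m
  - (8 * A2 ^+ 2 * A1) *: eta123 p p p
  + (8 * B1 * B2 * A2) *: (eta123 m m p + eta123 m p m).

(* The G2-structure phi and its Hodge dual *_phi phi, with t = r. *)
Definition phi (A1 A2 B1 B2 : R -> R) : form R := fun x =>
  let t := x.1.1 in
  dr R ^^ omega (A1 t) (A2 t) (B1 t) (B2 t)
  + Omega_plus (A1 t) (A2 t) (B1 t) (B2 t).

Definition star_phi (A1 A2 B1 B2 : R -> R) : form R := fun x =>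
  let t := x.1.1 in
  let w := omega (A1 t) (A2 t) (B1 t) (B2 t) in
  2^-1 *: (w ^^ w) - dr R ^^ Omega_minus (A1 t) (A2 t) (B1 t) (B2 t).

Definition coneA (r : R) : R := r / 3.
Definition coneB (r : R) : R := r / Num.sqrt 3.

Definition cone_phi : form R := phi coneA coneA coneB coneB.
Definition cone_star_phi : form R := star_phi coneA coneA coneB coneB.

End InvariantForms.

Definition lambertW (R : realType) : R -> R :=
  'pinv_(fun=> 0) [set x : R | 0 <= x] (fun x => x * expR x).

(* Main.v *)
Require Import Defs.
From mathcomp Require Import all_boot all_order all_algebra.
From mathcomp Require Import all_classical all_reals all_analysis.
From mathcomp Require Import ring.

Set Implicit Arguments.
Unset Strict Implicit.
Unset Printing Implicit Defensive.

Import Order.TTheory GRing.Theory Num.Theory.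
Import numFieldNormedType.Exports.
Local Open Scope ring_scope.
Local Open Scope ext_scope.

(** Put n = a1^2 + a2^2 + a3^2 and eta = sum_i a_i eta_i^+, so that A = f eta
    and F = f' dr /\ eta + f d eta; let psi be the Hodge dual of the
    G2-structure. The structure equations give
    d eta = P + N with P = -2 sum_i a_i eta_jk^{++} and
    N = -2 sum_i a_i eta_jk^{--}, (i, j, k) cyclic.

    Only terms containing dr survive in F^3 / 6 - F /\ psi: the others are
    (P + N)^3 and (P + N) /\ omega^2, and each of their monomials would need
    four of the three eta^+ or four of the three eta^-. What remains,
    including the product of f d eta with dr /\ Omega^-, is dr wedged with a
    multiple of eta_123^{+++} /\ sum_i a_i eta_jk^{--}. So the seven
    components of the equation reduce to one scalar equation; with A1 = A2 = A
    and B1 = B2 = B it reads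
      f' (4 n f^2 + (4 A B)^2) = f (16 A B^2 - 16 A^3)
    ([instanton_algebra]), and on the cone, where A = r / 3 and
    B = r / sqrt 3, it becomes
      f' (27 n f^2 + 4 r^4) = 8 r^3 f.

    The given f solves this equation: for u = W (4 k^2 r^4 / (27 n)) one has
    e^u = k^2 f^2, hence 4 r^4 = 27 n f^2 u, and differentiating
    u e^u = 4 k^2 r^4 / (27 n) gives the equation ([is_derive_profile]).

    That A is a smooth form also follows from the equation: it expresses f' as
    a rational function of r and f without poles on r > 0, so by induction all
    the derivatives of f are such functions ([rational_derive]), and frame
    derivatives of a function of r are functions of r again
    ([rational_radial_smooth]). *)

(** * The Lambert function *)

Section LambertW.
Variable R : realType.
Implicit Types x y : R.

Lemma xexp_inj :
  {in [set x : R | 0 <= x]%classic &, injective (fun x : R => x * expR x)}.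
Proof.
have incr x y : 0 <= x -> x < y -> x * expR x < y * expR y.
  move=> x0 xy; apply: (@le_lt_trans _ _ (x * expR y)).
    by rewrite ler_wpM2l// ler_expR ltW.
  by rewrite ltr_pM2r// expR_gt0.
move=> x y; rewrite !inE /= => x0 y0 xy.
by case: (ltgtP x y) => // [/(incr _ _ x0)|/(incr _ _ y0)]; rewrite xy ltxx.
Qed.

Lemma lambertW_xexp x : 0 <= x -> lambertW (x * expR x) = x.
Proof. by move=> x0; apply: (pinvKV _ xexp_inj); rewrite inE. Qed.

Lemma is_derive_xexp x :
  is_derive x 1 (fun x : R => x * expR x) (expR x * (1 + x)).
Proof.
apply: (is_derive_eq (is_deriveM (is_derive_id x 1) (is_derive_expR x))).
by rewrite /GRing.scale /= mulr1 mulrDr mulr1 addrC mulrC.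
Qed.

Lemma continuous_xexp x : {for x, continuous (fun x : R => x * expR x)}.
Proof.
apply: differentiable_continuous; apply/derivable1_diffP.
by have [] := is_derive_xexp x.
Qed.

(** By the intermediate value theorem on [0, y], the value y lies in the image
    of x e^x, so that the chosen inverse is an inverse on both sides. *)
Lemma xexp_lambertW y :
  0 <= y -> 0 <= lambertW y /\ lambertW y * expR (lambertW y) = y.
Proof.
move=> y0.
have [||x] := @IVT R (fun x => x * expR x) 0 y y y0.
- by apply: continuous_in_subspaceT => x _; exact: continuous_xexp.
- have yy : y <= y * expR y by rewrite ler_peMr// -expR0 ler_expR.
  by rewrite mul0r (min_idPl _) ?(max_idPr _) ?y0 ?yy// (le_trans y0).
by rewrite in_itv /= => /andP[x0 _] <-; rewrite lambertW_xexp.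
Qed.

Lemma lambertW_gt0 y : 0 < y -> 0 < lambertW y.
Proof.
move=> y0; have [W0 Wy] := xexp_lambertW (ltW y0).
rewrite lt_def W0 andbT; apply/eqP => WE.
by move: y0; rewrite -Wy WE mul0r ltxx.
Qed.

Lemma is_derive_lambertW y (u := lambertW y) :
  0 < y -> is_derive y 1 (@lambertW R) (expR u * (1 + u))^-1.
Proof.
move=> y0; have u0 : 0 < u by exact: lambertW_gt0.
have [_ /[dup] Wy {1}<-] := xexp_lambertW (ltW y0).
apply: (@is_derive_inverse R (fun x => x * expR x)).
- by near=> x; apply: lambertW_xexp; apply: ltW; near: x; exact: lt_nbhsr.
- by near=> x; exact: continuous_xexp.
- exact: is_derive_xexp.
- by rewrite gt_eqF// mulr_gt0 ?expR_gt0// addr_gt0.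
Unshelve. all: by end_near. Qed.

End LambertW.

(** * The radial profile *)

Section Profile.
Context {R : realType} (k n : R).
Hypotheses (k_gt0 : 0 < k) (n_gt0 : 0 < n).

Definition profile (r : R) : R :=
  k^-1 * expR (2^-1 * lambertW (4 * k ^+ 2 * r ^+ 4 / (27 * n))).

(** The value of the derivative that the scalar instanton equation forces. *)
Definition profile' (r : R) : R :=
  8 * r ^+ 3 * profile r * (27 * n * (profile r * profile r) + 4 * r ^+ 4)^-1.

Lemma profile_gt0 (r : R) : 0 < profile r.
Proof. by rewrite mulr_gt0 ?invr_gt0 ?expR_gt0. Qed.

Lemma profile_denom_gt0 (r : R) :
  0 < r -> 0 < 27 * n * (profile r * profile r) + 4 * r ^+ 4.
Proof.
move=> r0; have f0 := profile_gt0 r; have ff0 := mulr_gt0 f0 f0.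
by apply: addr_gt0; apply: mulr_gt0; rewrite ?exprn_gt0// mulr_gt0.
Qed.

(** The chain rule gives f' in terms of u = W y and e^u. Substituting
    e^u = k^2 f^2 and 4 r^4 = 27 n u f^2 eliminates the exponential and the
    Lambert function, leaving an identity of rational functions of r, f, u. *)
Lemma is_derive_profile (r : R) : 0 < r -> is_derive r 1 profile (profile' r).
Proof.
move=> r0; pose y : R := 4 * k ^+ 2 * r ^+ 4 / (27 * n).
have y0 : 0 < y by rewrite divr_gt0 ?mulr_gt0 ?exprn_gt0.
have [_ Wy] := xexp_lambertW (ltW y0).
have dW := is_derive_lambertW y0.
have dy : is_derive r 1 (fun r : R => 4 * k ^+ 2 * r ^+ 4 / (27 * n))
    (16 * k ^+ 2 * r ^+ 3 / (27 * n)).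
  pose c : R := 4 * k ^+ 2 / (27 * n).
  have -> : (fun r : R => 4 * k ^+ 2 * r ^+ 4 / (27 * n))
      = c \*: (fun r : R => r ^+ 4).
    by apply/funext => x; rewrite /c /= /GRing.scale /= mulrAC.
  apply: is_derive_eq; rewrite /GRing.scale /= /c.
  by field; rewrite gt_eqF.
have dWy := is_derive1_comp
  (g := fun r : R => 4 * k ^+ 2 * r ^+ 4 / (27 * n)) dW dy.
have dhalf := is_deriveZ (2^-1 : R) dWy.
have dexp := is_derive1_comp (is_derive_expR _) dhalf.
apply: (is_derive_eq (is_deriveZ (k^-1 : R) dexp)).
rewrite /GRing.scale /= /profile'.
have fE : profile r = k^-1 * expR (2^-1 * lambertW y) by [].
have kf : expR (lambertW y) = k ^+ 2 * (profile r * profile r).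
  rewrite fE -[X in expR X](_ : 2^-1 * lambertW y + 2^-1 * lambertW y = _);
    last by field.
  rewrite expRD; set e := expR (_ * _).
  by field; rewrite gt_eqF.
have r4 : 4 * r ^+ 4 = 27 * n * lambertW y * (profile r * profile r).
  apply: (mulfI (lt0r_neq0 (exprn_gt0 2 k_gt0))).
  have -> : k ^+ 2 * (27 * n * lambertW y * (profile r * profile r))
      = 27 * n * (lambertW y * expR (lambertW y)) by rewrite kf; ring.
  by rewrite Wy /y; field; rewrite gt_eqF.
have f0 := profile_gt0 r; have u0 := lambertW_gt0 y0.
have eE : expR (2^-1 *: lambertW y) = k * profile r.
  by rewrite fE mulrA divff ?mul1r// gt_eqF.
rewrite r4 -/y kf eE; field.
have D0 := profile_denom_gt0 r0.
by rewrite -r4 !gt_eqF// addr_gt0.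
Qed.

End Profile.

(** * Smoothness of radial functions *)

Lemma flow_radius (R : realType) (X : lie R) (m : Defs.point R) s :
  (flow X m s).1.1 = m.1.1 + s * X.1.1.
Proof. by []. Qed.

(** Along the flow of X the radius is r + s X_r, whether or not the S^3
    components of the flow stay on the spheres. *)
Lemma is_derive_flow (R : realType) (g : R -> R) (d : R) (X : lie R) G
    (m : Defs.point R) :
  (forall x : Defs.point R, 0 < x.1.1 -> G x = g x.1.1) ->
  0 < m.1.1 -> is_derive (m.1.1 : R) 1 g d ->
  is_derive (0 : R) 1 (fun s : R => G (flow X m s)) (d * X.1.1).
Proof.
move=> Gg m0 dg.
have dr : is_derive (0 : R) 1 (fun s : R => m.1.1 + s * X.1.1) X.1.1.
  have -> : (fun s : R => m.1.1 + s * X.1.1) = cst m.1.1 + X.1.1 \*: id.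
    by apply/funext => s; rewrite /GRing.scale /= mulrC.
  apply: (is_derive_eq (is_deriveD (is_derive_cst _ _ _)
    (is_deriveZ X.1.1 (is_derive_id (0 : R) 1)))).
  by rewrite add0r /GRing.scale /= mulr1.
have cont : {for (0 : R), continuous (fun s : R => m.1.1 + s * X.1.1)}.
  by apply: differentiable_continuous; apply/derivable1_diffP; case: dr.
apply: (@near_eq_is_derive _ _ _ (fun s : R => g (m.1.1 + s * X.1.1))).
  near=> s; rewrite Gg// flow_radius; near: s.
  apply: (cont [set x : R | 0 < x]%classic).
  by rewrite mul0r addr0; exact: lt_nbhsr.
apply: (is_derive1_comp (f := g) (g := fun s : R => m.1.1 + s * X.1.1) _ dr).
by rewrite mul0r addr0.
Unshelve. all: by end_near. Qed.

Section RationalClosure.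
Context {R : realType} (f : R -> R).

(** The functions of r that are rational in r and f, without poles for
    r > 0. *)
Inductive rational_in : (R -> R) -> Prop :=
| rational_cst c : rational_in (fun=> c)
| rational_id : rational_in id
| rational_fun : rational_in f
| rational_add g h :
    rational_in g -> rational_in h -> rational_in (fun r => g r + h r)
| rational_mul g h :
    rational_in g -> rational_in h -> rational_in (fun r => g r * h r)
| rational_inv g : rational_in g -> (forall r : R, 0 < r -> g r != 0) ->
    rational_in (fun r => (g r)^-1).

Lemma rational_exp g j :
  rational_in g -> rational_in (fun r => g r ^+ j).
Proof.
move=> rg; elim: j => [|j IH]; first exact: rational_cst.
rewrite (_ : (fun r => _) = (fun r => g r * g r ^+ j)).
  exact: rational_mul.
by apply/funext => r; rewrite exprS.
Qed.

Variable f' : R -> R.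
Hypotheses (rat_f' : rational_in f')
  (is_derive_f : forall r : R, 0 < r -> is_derive r 1 f (f' r)).

(** If f' is rational in r and f, the class is closed under differentiation,
    hence all its members are smooth on r > 0. *)
Lemma rational_derive g : rational_in g ->
  exists2 g', rational_in g' & forall r : R, 0 < r -> is_derive r 1 g (g' r).
Proof.
elim=> [c|||{}g h _ [g' rg dg] _ [h' rh dh]|{}g h rg [g' rg' dg] rh [h' rh' dh]|
  {}g rg [g' rg' dg] g0].
- by exists (fun=> 0) => [|r _]; [exact: rational_cst|exact: is_derive_cst].
- by exists (fun=> 1) => [|r _]; [exact: rational_cst|exact: is_derive_id].
- by exists f'.
- exists (fun r => g' r + h' r); first exact: rational_add.
  by move=> r r0; exact: (is_deriveD (dg r r0) (dh r r0)).
- exists (fun r => g r * h' r + h r * g' r).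
    by apply: rational_add; apply: rational_mul.
  by move=> r r0; exact: (is_deriveM (dg r r0) (dh r r0)).
- exists (fun r => -1 * ((g r)^-1 * (g r)^-1) * g' r).
    do 2!apply: rational_mul => //; first exact: rational_cst.
    by apply: rational_mul; exact: rational_inv.
  move=> r r0; apply: (is_derive_eq (is_deriveV (g0 r r0) (dg r r0))).
  by rewrite /GRing.scale /= mulN1r expr2 invfM.
Qed.

(** The agreement is only claimed for r > 0, where f satisfies its equation;
    it passes to derivatives because that set is open. *)
Lemma radial_iter_vderiv g s : rational_in g ->
  exists2 h, rational_in h & forall m : Defs.point R, 0 < m.1.1 ->
    iter_vderiv s (fun m : Defs.point R => g m.1.1) m = h m.1.1.
Proof.
move=> rg; elim: s => [|k s [h rh hE]] /=; first by exists g.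
have [h' rh' dh] := rational_derive rh.
exists (fun r => h' r * (frame R k).1.1).
  by apply: rational_mul => //; exact: rational_cst.
move=> m m0; rewrite /vderiv derive1E.
by have [_ ->] := is_derive_flow (frame R k) hE m0 (dh _ m0).
Qed.

Lemma rational_radial_smooth g :
  rational_in g -> smooth_fun (fun m : Defs.point R => g m.1.1).
Proof.
move=> rg s; have [h rh hE] := radial_iter_vderiv s rg.
have [h' _ dh] := rational_derive rh.
split=> [|k m [m0 _ _]]; last first.
  by have [] := is_derive_flow (frame R k) hE m0 (dh _ m0).
apply: (@subspace_eq_continuous _ _ _ (fun m : Defs.point R => h m.1.1)).
  by move=> m; rewrite inE => -[m0 _ _]; exact/esym/hE.
apply: continuous_in_subspaceT => m; rewrite inE => -[m0 _ _].
apply: (@continuous_comp _ _ _ (fun m : Defs.point R => m.1.1) h).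
  by apply: (@continuous_comp _ _ _ fst fst); exact: cvg_fst.
by apply: differentiable_continuous; apply/derivable1_diffP; case: (dh _ m0).
Qed.

End RationalClosure.

Lemma rational_profile' (R : realType) (k n : R) :
  0 < k -> 0 < n -> rational_in (profile k n) (profile' k n).
Proof.
move=> k0 n0; pose f := profile k n;
have r_cst := rational_cst f; have r_f := rational_fun f.
have r_exp j := rational_exp j (rational_id f).
apply: (rational_mul (rational_mul (rational_mul (r_cst 8) (r_exp 3)) r_f)).
apply: rational_inv => [|r r0]; last by rewrite gt_eqF// profile_denom_gt0.
apply: rational_add (rational_mul (r_cst 4) (r_exp 4)).
exact: (rational_mul (r_cst (27 * n)) (rational_mul r_f r_f)).
Qed.

(** * The wedge product *)

Section Wedge.
Context {R : realType}.
Implicit Types (a b c : ext R) (x : R) (A B S : {set 'I_7}).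

Lemma wedgeDl a b c : (a + b) ^^ c = a ^^ c + b ^^ c.
Proof.
apply/ffunP => S; rewrite !ffunE -big_split /=; apply: eq_bigr => A _.
by rewrite ffunE mulrDr mulrDl.
Qed.

Lemma wedgeDr a b c : a ^^ (b + c) = a ^^ b + a ^^ c.
Proof.
apply/ffunP => S; rewrite !ffunE -big_split /=; apply: eq_bigr => A _.
by rewrite ffunE mulrDr.
Qed.

Lemma wedgeZl x a b : (x *: a) ^^ b = x *: (a ^^ b).
Proof.
apply/ffunP => S; rewrite !ffunE scaler_sumr; apply: eq_bigr => A _.
by rewrite ffunE /GRing.scale /= -!mulrA mulrCA.
Qed.

Lemma wedgeZr x a b : a ^^ (x *: b) = x *: (a ^^ b).
Proof.
apply/ffunP => S; rewrite !ffunE scaler_sumr; apply: eq_bigr => A _.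
by rewrite ffunE /GRing.scale /= mulrCA.
Qed.

Lemma wedge0l a : (0 : ext R) ^^ a = 0.
Proof. by rewrite -(scale0r (0 : ext R)) wedgeZl !scale0r. Qed.

Lemma wedge0r a : a ^^ (0 : ext R) = 0.
Proof. by rewrite -(scale0r (0 : ext R)) wedgeZr !scale0r. Qed.

Lemma wedge_suml I (r : seq I) (P : pred I) (F : I -> ext R) b :
  (\sum_(i <- r | P i) F i) ^^ b = \sum_(i <- r | P i) F i ^^ b.
Proof.
exact: (big_morph (fun a => a ^^ b) (fun a c => wedgeDl a c b) (wedge0l b)).
Qed.

Lemma wedge_sumr I (r : seq I) (P : pred I) (F : I -> ext R) a :
  a ^^ (\sum_(i <- r | P i) F i) = \sum_(i <- r | P i) a ^^ F i.
Proof.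
exact: (big_morph (fun b => a ^^ b) (wedgeDr a) (wedge0r a)).
Qed.

Lemma wedge_monomial A B :
  monomial R A ^^ monomial R B =
  if [disjoint A & B] then shuffle_sign R A B *: monomial R (A :|: B) else 0.
Proof.
apply/ffunP => S; rewrite ffunE.
under eq_bigr => C _ do rewrite !ffunE.
rewrite (bigID (pred1 A)) /= [X in _ + X]big1 ?addr0; last first.
  by move=> C /andP[_ /negbTE->]; rewrite mulr0 mul0r.
have [AS|nAS] := boolP (A \subset S); last first.
  rewrite big_pred0; last first.
    by move=> C; apply/negP => /andP[+ /eqP CA]; rewrite CA (negbTE nAS).
  case: ifP => _; rewrite !ffunE// (_ : S == _ = false) ?scaler0//.
  by apply: contraNF nAS => /eqP->; exact: finset.subsetUl.
rewrite (big_pred1 A); last first.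
  by move=> C /=; case: (eqVneq C A) => [->|_]; rewrite ?AS ?andbF.
rewrite eqxx mulr1; have [dAB|ndAB] := boolP [disjoint A & B]; rewrite !ffunE.
  rewrite /GRing.scale /=; have -> : (S == A :|: B) = (S :\: A == B).
    apply/eqP/eqP => [->|<-]; last first.
      by rewrite finset.setDE finset.setUIr finset.setUCr finset.setIT
        (finset.setUidPr AS).
    rewrite finset.setDUl finset.setDv finset.set0U.
    by apply/finset.setDidPl; rewrite disjoint_sym.
  by case: eqP => [<-//|_]; rewrite !mulr0.
rewrite (_ : (S :\: A == B) = false) ?mulr0//.
apply: contraNF ndAB => /eqP <-; rewrite disjoint_sym.
by apply/finset.setDidPl; rewrite finset.setDDl finset.setUid.
Qed.

Lemma wedge_monomial0 a : a ^^ monomial R finset.set0 = a.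
Proof.
apply/ffunP => S; rewrite ffunE (bigD1 S) //= big1 => [|C /andP[CS nCS]].
  rewrite addr0 finset.setDv ffunE eqxx mulr1 /shuffle_sign eq_card0 ?expr0
      ?mul1r//.
  by move=> ij; rewrite !inE andbF.
rewrite ffunE finset.setD_eq0 (_ : S \subset C = false) ?mulr0//.
by apply: contraNF nCS => SC; rewrite finset.eqEsubset CS.
Qed.

(** Both sides vanish for k = l; otherwise exactly one of the two products is
    out of order. *)
Lemma covector_anticomm k l :
  covector R l ^^ covector R k = - (covector R k ^^ covector R l).
Proof.
have sgn i j : shuffle_sign R [set i] [set j] = (-1) ^+ (j < i)%N.
  rewrite /shuffle_sign; case: ltnP => ij; last first.
    rewrite eq_card0 ?expr0// => -[i' j']; rewrite !inE /=.
    by apply/negP => /and3P[/eqP-> /eqP->]; rewrite ltnNge ij.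
  rewrite (fintype.eq_card1 (x := (i, j))) ?expr1// => -[i' j'].
  rewrite !inE /= xpair_eqE.
  by case: eqP => //= ->; case: eqP => //= ->; rewrite ij.
rewrite /covector !wedge_monomial !disjoints1 !finset.in_set1.
case: eqVneq => [->|lk]; first by rewrite oppr0.
rewrite /= finset.setUC !sgn -scaleNr; congr (_ *: _).
case: ltngtP => [_|_|/val_inj/eqP]; rewrite ?expr1 ?expr0 ?opprK//.
by rewrite eq_sym (negbTE lk).
Qed.

End Wedge.

(** * The exterior derivative *)

Section Structure.
Context {R : realType}.

Lemma sum_frame (V : nmodType) (F : 'I_7 -> V) :
  \sum_k F k = F idr + \sum_i F (iplus i) + \sum_i F (iminus i).
Proof.
by rewrite (@big_split_ord _ _ _ (1 + 3) 3) (@big_split_ord _ _ _ 1 3) big_ord1.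
Qed.

Lemma frame_idr : frame R idr = (1, 0, 0).
Proof. by rewrite /frame /idr (unsplitK (inl _)) (unsplitK (inl _)). Qed.

Lemma frame_iplus i : frame R (iplus i) = (0, T R i, T R i).
Proof. by rewrite /frame /iplus (unsplitK (inl _)) (unsplitK (inr _)). Qed.

Lemma frame_iminus i : frame R (iminus i) = (0, T R i, - T R i).
Proof. by rewrite /frame /iminus (unsplitK (inr _)). Qed.

Lemma coframe_iplus i (X : lie R) :
  coframe (iplus i) X = (X.1.2 0 i + X.2 0 i) / 2.
Proof. by rewrite /coframe /iplus (unsplitK (inl _)) (unsplitK (inr _)). Qed.

Lemma su2_bracketE (u v : 'rV[R]_3) : su2_bracket u v = 2 *: cross u v.
Proof.
apply/rowP => i; rewrite !mxE /=; ring.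
Qed.

Lemma crossNN (u v : 'rV[R]_3) : cross (- u) (- v) = cross u v.
Proof. by apply/rowP => i; rewrite !mxE; ring. Qed.

Lemma crossvN (u v : 'rV[R]_3) : cross u (- v) = - cross u v.
Proof. by apply/rowP => i; rewrite !mxE; ring. Qed.

Lemma cross0v (u : 'rV[R]_3) : cross 0 u = 0.
Proof. by apply/rowP => i; rewrite !mxE; ring. Qed.

(** [T_j^+, T_k^+] and [T_j^-, T_k^-] are 2 eps_jki T_i^+, while the mixed
    brackets lie in the span of the T^-. Indices are taken modulo 3, so the
    right-hand side is -2 eta_jk^{++} - 2 eta_jk^{--} with (i, j, k) cyclic. *)
Lemma dcovector_plus i : dcovector R (iplus i) =
  (- 2) *: (etap R (i + 1) ^^ etap R (i + 2%:R)
            + etam R (i + 1) ^^ etam R (i + 2%:R)).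
Proof.
have -> : dcovector R (iplus i) =
  (- 2) *: (\sum_(a < 3) \sum_(b < 3 | (a < b)%N) cross (T R a) (T R b) 0 i *:
      (etap R a ^^ etap R b)
    + \sum_(a < 3) \sum_(b < 3 | (a < b)%N) cross (T R a) (T R b) 0 i *:
      (etam R a ^^ etam R b)).
  rewrite /dcovector.
  under eq_bigr => k _ do rewrite big_mkcond sum_frame /=.
  rewrite sum_frame scalerDr.
  have br k l : - coframe (iplus i) (lie_bracket (frame R k) (frame R l)) =
      - (cross (frame R k).1.2 (frame R l).1.2 0 i
         + cross (frame R k).2 (frame R l).2 0 i).
    by rewrite coframe_iplus /lie_bracket /= !su2_bracketE !mxE; field.
  have two (x : R) : - (x + x) = -2 * x by ring.
  rewrite [X in X + _ + _](_ : _ = 0) ?add0r; last first.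
    by rewrite !big1 ?addr0// => a _; rewrite br frame_idr /= !cross0v !mxE
      ?addr0 ?oppr0 scale0r ?if_same.
  congr (_ + _); rewrite scaler_sumr; apply: eq_bigr => a _.
    rewrite add0r [X in _ + X]big1 ?addr0; last first.
      by move=> b _; rewrite br frame_iplus frame_iminus /= crossvN !mxE subrr
        oppr0 scale0r ?if_same.
    rewrite [in RHS]big_mkcond scaler_sumr; apply: eq_bigr => b _.
    rewrite br !frame_iplus /= two -scalerA.
    rewrite -[X in (X < _)%N]/(1 + a)%N ltn_add2l.
    by case: ifP; rewrite ?scaler0.
  rewrite add0r [X in X + _]big1 ?add0r; last first.
    move=> b _; rewrite -[X in (X < _)%N]/(1 + 3 + a)%N -addnA ltn_add2l.
    by rewrite ltnNge (leq_trans (ltnW (ltn_ord b)))// leq_addr.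
  rewrite [in RHS]big_mkcond scaler_sumr; apply: eq_bigr => b _.
  rewrite br !frame_iminus /= crossNN two -scalerA ltn_add2l.
  by case: ifP; rewrite ?scaler0.
have sum_cross (u : 'I_3 -> ext R) :
    (forall a b, u b ^^ u a = - (u a ^^ u b)) ->
    \sum_(a < 3) \sum_(b < 3 | (a < b)%N)
      cross (T R a) (T R b) 0 i *: (u a ^^ u b) = u (i + 1) ^^ u (i + 2%:R).
  move=> uC; under eq_bigr => a _ do rewrite big_mkcond.
  rewrite !big_ord_recl !big_ord0 /= !mxE /=.
  have -> : lift ord0 (lift ord0 ord0) = 2%:R :> 'I_3 by exact: val_inj.
  have -> : lift ord0 ord0 = 1 :> 'I_3 by exact: val_inj.
  have -> : ord0 = 0 :> 'I_3 by exact: val_inj.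
  have : [|| i == 0, i == 1 | i == 2%:R] by case: i => [[|[|[|]]]].
  have [e1 e2] : 1 + 1 = 2%:R :> 'I_3 /\ 1 + 2%:R = 0 :> 'I_3.
    by split; exact: val_inj.
  have [e3 e4] : 2%:R + 1 = 0 :> 'I_3 /\ 2%:R + 2%:R = 1 :> 'I_3.
    by split; exact: val_inj.
  case/or3P => /eqP->; rewrite ?(add0r, e1, e2, e3, e4, addr0) -!val_eqE /=
    ?(mul0r, mulr0, mul1r, subr0, sub0r, oppr0, scale0r, scale1r,
      addr0, add0r) //.
  (* For i = 1 the pair (i + 1, i + 2) = (2, 0) is out of order. *)
  by rewrite scaleN1r -uC.
rewrite !sum_cross// => a b; exact: covector_anticomm.
Qed.

(** The exterior derivative of a left-invariant form. *)
Definition dconst (E : ext R) : ext R :=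
  \sum_k dcovector R k ^^ Defs.contract k E.

Lemma dconstD a b : dconst (a + b) = dconst a + dconst b.
Proof.
rewrite /dconst -big_split; apply: eq_bigr => k _ /=; rewrite -wedgeDr.
congr (_ ^^ _); apply/ffunP => S; rewrite !ffunE.
by case: ifP => _; rewrite ?addr0 // mulrDr.
Qed.

Lemma dconstZ x a : dconst (x *: a) = x *: dconst a.
Proof.
rewrite /dconst scaler_sumr; apply: eq_bigr => k _; rewrite -wedgeZr.
congr (_ ^^ _); apply/ffunP => S; rewrite !ffunE.
by case: ifP => _; rewrite ?scaler0// /GRing.scale /= mulrCA.
Qed.

Lemma contract_covector k l :
  Defs.contract k (covector R l) = (k == l)%:R *: monomial R finset.set0.
Proof.
apply/ffunP => S; rewrite !ffunE.
have [->|S0] := eqVneq S finset.set0.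
  rewrite finset.in_set0 finset.setU0 /shuffle_sign eq_card0 => [|ij];
    last by rewrite !inE andbF.
  rewrite expr0 mul1r (inj_eq finset.set1_inj) /GRing.scale /=.
  by rewrite mulr1.
rewrite scaler0; case: ifPn => // kS.
rewrite (_ : (k |: S == _) = false) ?mulr0//; apply/negP => /eqP kSl.
case/finset.set0Pn: S0 => j jS.
have : j \in [set l] by rewrite -kSl !inE jS orbT.
have : k \in [set l] by rewrite -kSl !inE eqxx.
by rewrite !inE => /eqP kl /eqP jl; rewrite kl -jl jS in kS.
Qed.

Lemma dconst_covector k : dconst (covector R k) = dcovector R k.
Proof.
rewrite /dconst (bigD1 k)//= big1 => [|l /negbTE lk].
  by rewrite contract_covector eqxx scale1r wedge_monomial0 addr0.
by rewrite contract_covector lk scale0r wedge0r.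
Qed.

(** The frame fields other than d/dr annihilate functions of r, so that dg is
    a multiple of dr. *)
Lemma dform_radial (g : R -> R) (d : R) (E : ext R) (m : Defs.point R) :
  0 < m.1.1 -> is_derive (m.1.1 : R) 1 g d ->
  dform (fun x => g x.1.1 *: E) m = d *: (dr R ^^ E) + g m.1.1 *: dconst E.
Proof.
move=> m0 dg; rewrite /dform -dconstZ; congr (_ + _).
have dE k : ([ffun S : {set 'I_7} =>
      vderiv (frame R k) (fun x : Defs.point R => (g x.1.1 *: E) S) m] : ext R)
    = (d * (frame R k).1.1) *: E.
  apply/ffunP => S; rewrite !ffunE /vderiv derive1E.
  have dgE : is_derive (m.1.1 : R) 1 (E S \*: g) (E S * d) by exact: is_deriveZ.
  have [|_ ->] := is_derive_flow (G := fun x => (g x.1.1 *: E) S) (frame R k)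
    _ m0 dgE.
    by move=> x _; rewrite ffunE /GRing.scale /= mulrC.
  by rewrite /GRing.scale /= [E S * d]mulrC -!mulrA [E S * _]mulrC.
under eq_bigr => k _ do rewrite dE wedgeZr.
rewrite sum_frame !big1 ?addr0 => [|i _|i _].
- by rewrite frame_idr mulr1.
- by rewrite frame_iminus mulr0 scale0r.
- by rewrite frame_iplus mulr0 scale0r.
Qed.

End Structure.

(** * Forms as lists of terms *)

Section Expansion.
Context {R : realType}.
Implicit Types (s t : seq nat) (x y : R) (a b : seq (R * seq nat)).

(** The ring operations under names of their own, so that the call-by-value
    evaluation in [instanton_algebra] runs through words and signs but leaves
    the coefficients as they are. *)
Definition coef_add x y := x + y.
Definition coef_mul x y := x * y.
Definition coef_opp x := - x.
Definition coef_zero : R := 0.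
Definition coef_one : R := 1.

Definition index_set s : {set 'I_7} := [set i : 'I_7 | val i \in s].

(** Forms given by explicit lists of terms; a word is a list of coframe
    numbers, standing for the set of its letters. *)
Definition expand a : ext R :=
  \sum_(p <- a) p.1 *: monomial R (index_set p.2).

(** The inversions of the concatenation of two sorted words. Letters are looked
    up in [iota 0 7], which makes words that are unsorted or have repeated
    letters or letters beyond 6 harmless. *)
Definition inversions s t : nat :=
  sumn [seq count (fun j => [&& i \in s, j \in t & (j < i)%N]) (iota 0 7)
       | i <- iota 0 7].

Definition overlap s t : bool :=
  has (fun i => (i \in s) && (i \in t)) (iota 0 7).

Definition merge_words s t : seq nat :=
  [seq i <- iota 0 7 | (i \in s) || (i \in t)].

Definition wedge_term (p q : R * seq nat) : seq (R * seq nat) :=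
  if overlap p.2 q.2 then [::] else
  let c := coef_mul p.1 q.1 in
  [:: (if odd (inversions p.2 q.2) then coef_opp c else c,
       merge_words p.2 q.2)].

Definition wedge_list a b : seq (R * seq nat) :=
  flatten [seq flatten [seq wedge_term p q | q <- b] | p <- a].

Definition scale_list x a : seq (R * seq nat) :=
  [seq (coef_mul x p.1, p.2) | p <- a].

Definition coefficient s a : R :=
  foldr (fun p c => if p.2 == s then coef_add p.1 c else c) coef_zero a.

Lemma shuffle_sign_index_set s t :
  shuffle_sign R (index_set s) (index_set t) = (-1) ^+ inversions s t.
Proof.
congr (_ ^+ _); rewrite -sum1_card big_mkcond /=.
rewrite -(pair_bigA _ (fun i j : 'I_7 =>
  if (i, j) \in [pred ij | [&& ij.1 \in index_set s, ij.2 \in index_set t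
    & (ij.2 < ij.1)%N]] then 1 else 0)%N) /=.
rewrite /inversions sumnE big_map -[iota 0 7]/(index_iota 0 7) big_mkord.
apply: eq_bigr => i _; rewrite -sum1_count big_mkord [RHS]big_mkcond.
by apply: eq_bigr => j _; rewrite !inE.
Qed.

Lemma disjoint_index_set s t :
  [disjoint index_set s & index_set t] = ~~ overlap s t.
Proof.
rewrite disjoint_subset; apply/fintype.subsetP/hasPn => [st i | st i].
  rewrite mem_iota /= => i7; have := st (Ordinal i7); rewrite !inE /=.
  by case: (i \in s) => //= /(_ isT).
rewrite !inE => si; have := st (val i); rewrite mem_iota /= ltn_ord => /(_ isT).
by rewrite si.
Qed.

Lemma index_setU s t :
  index_set s :|: index_set t = index_set (merge_words s t).
Proof.
by apply/finset.setP => i; rewrite !inE mem_filter mem_iota /= ltn_ord andbT.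
Qed.

Lemma expand_cat a b : expand (a ++ b) = expand a + expand b.
Proof. by rewrite /expand big_cat. Qed.

Lemma expand_scale x a : expand (scale_list x a) = x *: expand a.
Proof.
by rewrite /expand big_map scaler_sumr; apply: eq_bigr => p _; rewrite scalerA.
Qed.

Lemma expand_opp a : expand (scale_list (coef_opp coef_one) a) = - expand a.
Proof. by rewrite expand_scale scaleN1r. Qed.

Lemma expand_wedge a b : expand (wedge_list a b) = expand a ^^ expand b.
Proof.
rewrite /expand big_flatten big_map wedge_suml; apply: eq_bigr => p _.
rewrite big_flatten big_map wedge_sumr; apply: eq_bigr => q _.
rewrite wedgeZl wedgeZr wedge_monomial disjoint_index_set /wedge_term.
case: overlap => /=; first by rewrite big_nil !scaler0.
rewrite big_seq1 /= index_setU shuffle_sign_index_set -signr_odd !scalerA.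
by case: odd; rewrite ?mulr1// mulrN1.
Qed.

Lemma expand_covector k : covector R k = expand [:: (coef_one, [:: val k])].
Proof.
rewrite /expand big_seq1 scale1r; congr monomial.
by apply/finset.setP => i; rewrite !inE.
Qed.

(** Collecting terms: a linear combination of monomials vanishes as soon as
    the coefficient of each word that occurs does. The condition is phrased as
    a fold so that it evaluates to an explicit conjunction. *)
Lemma expand_eq0 a :
  foldr (fun s P => coefficient s a = coef_zero /\ P) True
    (undup [seq p.2 | p <- a]) -> expand a = 0.
Proof.
have coefE s : coefficient s a = \sum_(p <- a | p.2 == s) p.1.
  rewrite /coefficient; elim: a => [|p a IH] /=; first by rewrite big_nil.
  by rewrite big_cons IH.
have -> : expand a = \sum_(s <- undup [seq p.2 | p <- a])
    coefficient s a *: monomial R (index_set s).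
  under [RHS]eq_bigr => s _ do rewrite coefE scaler_suml.
  rewrite (exchange_big_dep predT) //= /expand; apply: eq_big_seq => p pa.
  rewrite big_mkcond (bigD1_seq p.2) ?undup_uniq ?mem_undup ?map_f//= eqxx.
  by rewrite big1 ?addr0// => s /negbTE; rewrite eq_sym => ->.
elim: (undup _) => [|s u IH]; rewrite ?big_nil// big_cons => -[-> /IH->].
by rewrite scale0r addr0.
Qed.

End Expansion.

(** * The instanton equation *)

(** Here p and q are the values of f' and f at a point. All the forms involved
    are explicit combinations of monomials, so the equation is checked
    component by component; the components that do not cancel identically are
    a1, a2, a3 times one scalar, up to sign. *)
Lemma instanton_algebra (R : realType) (p q a1 a2 a3 A B : R) :
  p * (4 * (a1 ^+ 2 + a2 ^+ 2 + a3 ^+ 2) * q ^+ 2 + (4 * A * B) ^+ 2)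
    = q * (16 * A * B ^+ 2 - 16 * A ^+ 3) ->
  let eta := a1 *: etap R 0 + a2 *: etap R 1 + a3 *: etap R 2%:R in
  let F := p *: (dr R ^^ eta) + q *: dconst eta in
  let w := omega A A B B in
  6^-1 *: (F ^^ F ^^ F)
  - F ^^ (2^-1 *: (w ^^ w) - dr R ^^ Omega_minus A A B B) = 0.
Proof.
move=> H /=.
rewrite !dconstD !dconstZ !dconst_covector !dcovector_plus.
rewrite /omega /Omega_minus.
(* Constants become variables, so that evaluation does not unfold them. *)
have [c6 c6E] : {c : R | c = 6^-1} by exists 6^-1.
have [c2 c2E] : {c : R | c = 2^-1} by exists 2^-1.
have [m2 m2E] : {c : R | c = -2} by exists (-2).
have [u uE] : {c : R | c = 4 * A * B} by exists (4 * A * B).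
have [x xE] : {c : R | c = 8 * A * B ^+ 2} by exists (8 * A * B ^+ 2).
have [y yE] : {c : R | c = 8 * A ^+ 2 * A} by exists (8 * A ^+ 2 * A).
have [z zE] : {c : R | c = 8 * B * B * A} by exists (8 * B * B * A).
rewrite -c6E -c2E -m2E -uE -xE -yE -zE.
rewrite !add0r.
have [-> -> -> ->] : [/\ 1 + 1 = 2%:R :> 'I_3, 1 + 2%:R = 0 :> 'I_3,
    2%:R + 1 = 0 :> 'I_3 & 2%:R + 2%:R = 1 :> 'I_3] by split; exact: val_inj.
rewrite /eta123 /dr /etap /etam !expand_covector.
have -> : val idr = 0%N by [].
have [-> -> ->] : [/\ val (iplus 0) = 1%N, val (iplus 1) = 2%N
    & val (iplus 2%:R) = 3%N] by [].
have [-> -> ->] : [/\ val (iminus 0) = 4%N, val (iminus 1) = 5%N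
    & val (iminus 2%:R) = 6%N] by [].
rewrite -?(expand_wedge, expand_cat, expand_scale, expand_opp).
apply: expand_eq0.
cbv -[coef_add coef_mul coef_opp coef_zero coef_one Real.sort].
rewrite /coef_add /coef_mul /coef_opp /coef_zero /coef_one.
pose E := p * (4 * (a1 ^+ 2 + a2 ^+ 2 + a3 ^+ 2) * q ^+ 2 + u ^+ 2)
  - q * (2 * z - 2 * y).
have E0 : E = 0 by rewrite /E uE H yE zE; ring.
have -> : x = z by rewrite xE zE; ring.
repeat split; rewrite c6E c2E m2E.
(* Only the components of dr /\ eta_123^{+++} /\ eta_jk^{--} survive. *)
all: try by field.
- by transitivity (a1 * E); [rewrite /E; field | rewrite E0 mulr0].
- by transitivity (- a2 * E); [rewrite /E; field | rewrite E0 mulr0].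
- by transitivity (a3 * E); [rewrite /E; field | rewrite E0 mulr0].
Qed.

Lemma cone_coefficients (R : realType) (r : R) :
  (4 * coneA r * coneB r) ^+ 2 = 16 / 27 * r ^+ 4 /\
  16 * coneA r * coneB r ^+ 2 - 16 * coneA r ^+ 3 = 32 / 27 * r ^+ 3.
Proof.
have B2 : coneB r ^+ 2 = r ^+ 2 / 3 by rewrite /coneB expr_div_n sqr_sqrtr.
split; last by rewrite B2 /coneA; field.
by rewrite exprMn B2 /coneA; field.
Qed.

Theorem theorem5p1 (R : realType) (k a1 a2 a3 : R) (hk : 0 < k)
    (ha : ~ (a1 = 0 /\ a2 = 0 /\ a3 = 0)) :
  let f (r : R) : R :=
    k^-1 * expR (2^-1 * lambertW (4 * k ^+ 2 * r ^+ 4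
                                  / (27 * (a1 ^+ 2 + a2 ^+ 2 + a3 ^+ 2)))) in
  deformed_G2_instanton cone_star_phi
    (fun x => f x.1.1 *: (a1 *: etap R 0 + a2 *: etap R 1 + a3 *: etap R 2%:R)).
Proof.
move=> f; pose n : R := a1 ^+ 2 + a2 ^+ 2 + a3 ^+ 2.
have n0 : 0 < n.
  rewrite lt_def !addr_ge0 ?sqr_ge0// andbT; apply/eqP => nE; apply: ha.
  move/eqP: nE; rewrite !paddr_eq0 ?addr_ge0 ?sqr_ge0// !sqrf_eq0.
  by case/andP=> /andP[/eqP-> /eqP->] /eqP->.
pose E : ext R := a1 *: etap R 0 + a2 *: etap R 1 + a3 *: etap R 2%:R.
split; first split.
- move=> m _ S S1; rewrite !ffunE.
  have S0 (l : 'I_7) : (S == [set l]%SET) = false.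
    by apply: contraNF S1 => /eqP->; rewrite cards1.
  by rewrite !S0 !scaler0 !addr0 scaler0.
- move=> S; have := rational_radial_smooth (rational_profile' hk n0)
    (is_derive_profile hk n0)
    (rational_mul (rational_fun _) (rational_cst _ (E S))).
  by congr smooth_fun; apply/funext => m; rewrite [RHS]ffunE.
- move=> m Mm; have [m0 _ _] := Mm.
  rewrite /= (dform_radial E m0 (is_derive_profile hk n0 m0)).
  apply: instanton_algebra.
  have [-> ->] := cone_coefficients m.1.1.
  have D0 := profile_denom_gt0 hk n0 m0.
  by rewrite -/n /profile'; field; rewrite gt_eqF.
Qed.
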